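(* Let $G$ be a weakly connected digraph and $x,y$ chip-distributions on $G$ such that there exists $f\in\mathbb{Z}_+^V$ with $y=x+Lf$. Suppose that for each strongly connected component $G'=(V',E')$ of $G$, either $f|_{V'}=\mathbf{0}$ or $y|_{V'}$ is a recurrent chip-distribution on $G'$. Then $x\leadsto y$.
   Context: A digraph is a weakly connected directed graph on a finite vertex set $V$, possibly with multiple edges but no loops. $\overrightarrow{d}(u,v)$ is the number of edges from $u$ to $v$ and $d^+(v)$ the out-degree. The Laplacian $L$ has $L(v,v)=-d^+(v)$ and $L(u,v)=\overrightarrow{d}(v,u)$ for $u\ne v$. A chip-distribution is $x\in\mathbb{Z}_+^V$. Firing $v$ replaces $x$ by $x+L\mathbf{1}_v$; it is legal if $x(v)\ge d^+(v)$. $x\leadsto y$ means some legal sequence of firings (possibly empty) transforms $x$ into $y$. A chip-distribution on a digraph $H$ is recurrent if some non-empty legal sequence of firings on $H$ transforms it into itself; for a strongly connected component $G'=(V',E')$ (the subgraph induced on $V'$), $y|_{V'}$ is regarded as a chip-distribution on $G'$. *)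

(* Defs.v *)
From HB Require Import structures.
From mathcomp Require Import all_boot all_order all_algebra.

Set Implicit Arguments.
Unset Strict Implicit.
Unset Printing Implicit Defensive.

Import GRing.Theory.
Local Open Scope ring_scope.

(* [mult G u v] is the number of edges from u to v. Weak connectivity is kept
   as a separate predicate so that induced subgraphs need no side proof. *)
Record digraph (V : finType) := Digraph {
  mult : V -> V -> nat;
  mult_irrefl : forall v, mult v v = 0%N
}.

Section Digraph.

Variables (V : finType) (G : digraph V).

Definition edge : rel V := fun u v => (0 < mult G u v)%N.

Definition weakly_connected : Prop :=
  forall u v : V, connect (fun a b => edge a b || edge b a) u v.

Definition mutually_reachable : rel V :=
  fun u v => connect edge u v && connect edge v u.

Definition strong_component (C : {set V}) : bool :=
  C \in equivalence_partition mutually_reachable [set: V].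

Definition outdeg (v : V) : nat := (\sum_(u : V) mult G v u)%N.

Definition laplacian (u v : V) : int :=
  if u == v then - (outdeg v)%:Z else (mult G v u)%:Z.

Definition laplacian_mul (f : {ffun V -> int}) : {ffun V -> int} :=
  [ffun u => \sum_(v : V) laplacian u v * f v].

Definition char_vec (v : V) : {ffun V -> int} := [ffun u => (u == v)%:Z].

Definition to_int (x : {ffun V -> nat}) : {ffun V -> int} :=
  [ffun v => (x v)%:Z].

Definition legal_firing (x : {ffun V -> nat}) (v : V) (y : {ffun V -> nat}) :
    Prop :=
  (outdeg v <= x v)%N /\ to_int y = to_int x + laplacian_mul (char_vec v).

Fixpoint legal_sequence (x : {ffun V -> nat}) (s : seq V)
    (y : {ffun V -> nat}) : Prop :=
  if s is v :: s' then
    exists z, legal_firing x v z /\ legal_sequence z s' y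
  else x = y.

Definition reachable (x y : {ffun V -> nat}) : Prop :=
  exists s : seq V, legal_sequence x s y.

(* On a single vertex without edges, firing is the (legal) identity, so there
   every chip-distribution is recurrent. *)
Definition recurrent (x : {ffun V -> nat}) : Prop :=
  exists2 s : seq V, s <> [::] & legal_sequence x s x.

Definition induced (C : {set V}) : digraph {v : V | v \in C} :=
  Digraph (mult := fun u v => mult G (val u) (val v))
    (fun v => mult_irrefl G (val v)).

End Digraph.

Definition restrict (V : finType) (C : {set V}) (x : {ffun V -> nat}) :
    {ffun {v : V | v \in C} -> nat} :=
  [ffun v => x (val v)].

(* Main.v *)
Require Import Defs.
From mathcomp Require Import all_boot all_order all_algebra.
From mathcomp Require Import zify.
Local Open Scope ring_scope.

(** Fire greedily, never exceeding [f]. Suppose the process gets stuck at [x]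
    with a remaining demand [f] that is not zero, and let [C] be a component
    meeting the support of [f], as far upstream as possible. On the induced
    graph of [C], the recurrent distribution [y] admits a legal closed sequence
    firing every vertex [v] at least [f v] times, say [p v] times. Before
    the first firing of some [v] beyond its first [p v - f v] ones, [v] holds
    at least its out-degree within [C]. As the Laplacian of [C] kills [p],
    undoing [f] from [y] leaves [v] with at least that many chips, plus those
    returned along the edges leaving [C]: so [v] is fireable at [x]. *)

Import GRing.Theory Num.Theory.

Set Implicit Arguments.
Unset Strict Implicit.

Section ChipFiring.

Variables (V : finType) (G : digraph V).
Implicit Types (x y z f h : {ffun V -> nat}) (s : seq V) (u v w : V).

Definition firing_vector s : {ffun V -> nat} := [ffun v => count_mem v s].

Lemma laplacian_mulD (f g : {ffun V -> int}) :
  laplacian_mul G (f + g) = laplacian_mul G f + laplacian_mul G g.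
Proof.
by apply/ffunP => u; rewrite !ffunE -big_split; apply: eq_bigr => v _;
  rewrite ffunE mulrDr.
Qed.

Lemma laplacian_mulE f v :
  laplacian_mul G (to_int f) v
  = (\sum_u mult G u v * f u)%N%:Z - (outdeg G v * f v)%N%:Z.
Proof.
rewrite ffunE (bigD1 v) //= /laplacian eqxx ffunE mulNr -PoszM addrC.
congr (_ - _); rewrite [in RHS](bigD1 v) //= mult_irrefl mul0n add0n.
rewrite (big_morph Posz PoszD (erefl _)); apply: eq_bigr => u uv.
by rewrite ffunE eq_sym (negPf uv).
Qed.

Lemma to_int_cons v s :
  to_int (firing_vector (v :: s)) = char_vec v + to_int (firing_vector s).
Proof. by apply/ffunP => u; rewrite !ffunE /= PoszD eq_sym. Qed.

Lemma legal_sequence_laplacian x s y : legal_sequence G x s y ->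
  to_int y = to_int x + laplacian_mul G (to_int (firing_vector s)).
Proof.
elim: s x => [|v s IH] x /=.
  move=> ->; apply/ffunP => u; rewrite [RHS]ffunE laplacian_mulE !ffunE /=.
  by rewrite big1 ?muln0 ?subr0 ?addr0 // => w _; rewrite ffunE muln0.
by move=> [z [[_ zE] /IH->]]; rewrite to_int_cons laplacian_mulD zE addrA.
Qed.

Lemma legal_sequence_cat x y z s t :
  legal_sequence G x s y -> legal_sequence G y t z ->
  legal_sequence G x (s ++ t) z.
Proof.
elim: s x => [|v s IH] x /=; first by move=> ->.
by move=> [w [xw ws]] yz; exists w; split=> //; apply: IH.
Qed.

(** Look at the first firing of some [v] beyond its [h v] allowed ones. By then [v] has fired
    exactly [h v] times and every other vertex [u] at most [h u] times; firing these further only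
    adds chips to [v], so the legality bound persists. *)
Lemma legal_sequence_overshoot x s y h :
  legal_sequence G x s y -> (exists v, (h v < count_mem v s)%N) ->
  exists v, (h v < count_mem v s)%N /\
    (outdeg G v)%:Z <= (to_int x + laplacian_mul G (to_int h)) v.
Proof.
elim: s x h => [|v s IH] x h /=; first by move=> _ [].
move=> [z [[vx zE] zs]] [w hw].
have [hv0|hv_gt0] := posnP (h v).
  exists v; rewrite hv0 eqxx; split=> //.
  by rewrite [leRHS]ffunE laplacian_mulE ffunE hv0; lia.
pose h' : {ffun V -> nat} := [ffun u => (h u - (u == v))%N].
have hE : to_int h = char_vec v + to_int h'.
  apply/ffunP => u; rewrite !ffunE.
  by case: (u =P v) => [->|_] /=; lia.
have [|u [hu le_u]] := IH z h' zs.
  by exists w; move: hw; rewrite ffunE (eq_sym v w); case: (w =P v) => [->|_] /=; lia.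
exists u; split; last by rewrite hE laplacian_mulD addrA -zE.
by move: hu; rewrite ffunE (eq_sym v u); case: (u =P v) => [->|_] /=; lia.
Qed.

(** At [a] the kernel equation balances inflow against [outdeg G a * f a], so positivity passes
    along each edge. *)
Lemma harmonic_gt0 f : (forall u v, connect (edge G) u v) ->
  laplacian_mul G (to_int f) = 0 -> (exists v, 0 < f v)%N ->
  forall v, (0 < f v)%N.
Proof.
move=> Gconn Lf0 [w fw_gt0] v.
have /connectP[p] := Gconn w v.
elim: p w fw_gt0 => [|a p IH] w fw_gt0 /=; first by move=> _ ->.
case/andP=> wa ap vE; apply: (IH a) => //.
have := laplacian_mulE f a; rewrite Lf0 ffunE (bigD1 w) //=.
by move: wa; rewrite /edge; case: (f a) => // *; nia.
Qed.

(** The firing vector of a closed sequence lies in the kernel of the Laplacian, hence is positive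
    everywhere; repeat the sequence [n] times. *)
Lemma recurrent_long_cycle y n :
  (forall u v, connect (edge G) u v) -> recurrent G y ->
  exists2 s, legal_sequence G y s y & forall v, (n <= count_mem v s)%N.
Proof.
move=> Gconn [s s0 ys].
have s_gt0 : forall v, (0 < firing_vector s v)%N.
  apply: harmonic_gt0 => //.
    by apply: (addrI (to_int y)); rewrite -(legal_sequence_laplacian ys) addr0.
  by case: s s0 {ys} => // v s _; exists v; rewrite ffunE /= eqxx.
elim: n => [|n [t yt ltn]]; first by exists [::].
exists (s ++ t); first exact: legal_sequence_cat yt.
by move=> v; rewrite count_cat; have := ltn v; have := s_gt0 v; rewrite ffunE; lia.
Qed.

(* A counterpart, for arbitrary demands, of Dhar's burning criterion. *)
Lemma recurrent_unfire y f :
  (forall u v, connect (edge G) u v) -> recurrent G y -> (exists v, 0 < f v)%N ->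
  exists v, (0 < f v)%N /\
    (outdeg G v)%:Z <= (to_int y - laplacian_mul G (to_int f)) v.
Proof.
move=> Gconn yrec [w fw_gt0].
(* The total of [f] serves as a uniform bound on its values. *)
have [s ys les] := recurrent_long_cycle (\sum_v f v) Gconn yrec.
have lefs v : (f v <= count_mem v s)%N.
  by apply: leq_trans (les v); rewrite (bigD1 v) //= leq_addr.
pose h : {ffun V -> nat} := [ffun v => (count_mem v s - f v)%N].
have hE : to_int (firing_vector s) = to_int h + to_int f.
  by apply/ffunP => v; rewrite !ffunE; have := lefs v; lia.
have LhE : laplacian_mul G (to_int h) = - laplacian_mul G (to_int f).
  apply/eqP; rewrite -addr_eq0 -laplacian_mulD -hE; apply/eqP.
  by apply: (addrI (to_int y)); rewrite -(legal_sequence_laplacian ys) addr0.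
have [|v [hv le_v]] := legal_sequence_overshoot (h := h) ys.
  by exists w; rewrite ffunE; have := lefs w; lia.
by exists v; rewrite -LhE; split=> //; move: hv; rewrite ffunE; lia.
Qed.

End ChipFiring.

Section StrongComponents.

Variables (V : finType) (G : digraph V).
Implicit Types (x y z f : {ffun V -> nat}) (u v w : V).

Lemma strong_component_of v :
  strong_component G [set w | mutually_reachable G v w].
Proof.
apply/imsetP; exists v => //.
by apply/setP => w; rewrite !inE.
Qed.

(** A path in [G] between two vertices of [C] never leaves [C]. *)
Lemma induced_connected v0 (C := [set w | mutually_reachable G v0 w])
  (a b : {w | w \in C}) : connect (edge (induced G C)) a b.
Proof.
have CP (w : {w | w \in C}) :
    connect (edge G) v0 (val w) /\ connect (edge G) (val w) v0.
  by have := valP w; rewrite inE => /andP[].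
have /connectP[p] := connect_trans (CP a).2 (CP b).1.
elim: p a => [|c p IH] a /=; first by move=> _ /val_inj->; rewrite connect0.
case/andP=> ac cp bE.
have cC : c \in C.
  rewrite inE; apply/andP; split.
    exact: connect_trans (CP a).1 (connect1 ac).
  by apply: connect_trans (CP b).2; apply/connectP; exists p.
apply: (@connect_trans _ _ (Sub c cC)); last exact: IH.
by apply: connect1; rewrite /edge /=.
Qed.

Lemma exists_fireable x y f :
  to_int y = to_int x + laplacian_mul G (to_int f) ->
  (forall C : {set V}, strong_component G C ->
     restrict C f = [ffun=> 0%N] \/ recurrent (induced G C) (restrict C y)) ->
  (exists v, 0 < f v)%N -> exists v, (0 < f v)%N /\ (outdeg G v <= x v)%N.
Proof.
move=> yE hC [w fw_gt0].
(* Having the fewest ancestors within the support of [f] puts the component of [v0] as far upstream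
   as possible. *)
case: (@arg_minnP _ w (fun v => 0 < f v)%N
  (fun v => #|[set u | connect (edge G) u v]|) fw_gt0) => v0 fv0 v0_min.
pose C := [set w | mutually_reachable G v0 w].
have v0C : v0 \in C by rewrite inE /mutually_reachable connect0.
(* If [f u] were positive, minimality would give [u] and [v0] the same ancestors, so [v0] would
   reach [u] and [u] would lie in [C]. *)
have Cup u v : v \in C -> edge G u v -> u \notin C -> f u = 0%N.
  rewrite !inE => /andP[v0v vv0] uv; apply: contraNeq; rewrite -lt0n => fu.
  have uv0 := connect_trans (connect1 uv) vv0.
  have sub : [set t | connect (edge G) t u] \subset [set t | connect (edge G) t v0].
    by apply/subsetP => t; rewrite !inE => tu; apply: connect_trans uv0.
  have : [set t | connect (edge G) t u] == [set t | connect (edge G) t v0].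
    by rewrite eqEcard sub v0_min.
  by move=> /eqP/setP/(_ v0); rewrite !inE connect0 /mutually_reachable uv0 => ->.
have [/ffunP/(_ (Sub v0 v0C))|yrec] := hC C (strong_component_of v0).
  by rewrite !ffunE /= => fv0_eq0; rewrite fv0_eq0 in fv0.
have [|v [fv le_v]] :=
  recurrent_unfire (f := restrict C f) (@induced_connected v0) yrec.
  by exists (Sub v0 v0C); rewrite ffunE.
exists (val v); move: fv; rewrite ffunE => fv; split=> //.
have sumC (F : V -> nat) :
    (\sum_(u : {u | u \in C}) F (val u) = \sum_(u in C) F u)%N.
  exact: esym (big_sub _ _).
have inC : (\sum_(u : {u | u \in C}) mult (induced G C) u v * restrict C f u
            = \sum_u mult G u (val v) * f u)%N.
  rewrite [RHS](bigID (mem C)) /= [X in (_ + X)%N]big1 ?addn0.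
    by rewrite -sumC; apply: eq_bigr => u _; rewrite ffunE.
  move=> u uC; case: (posnP (mult G u (val v))) => [->//|uv].
  by rewrite (Cup u (val v) (valP v)) ?muln0.
have outC : (outdeg (induced G C) v <= outdeg G (val v))%N.
  rewrite /outdeg [leqRHS](bigID (mem C)) /= -(sumC (fun u => mult G (val v) u)).
  exact: leq_addr.
move/ffunP: yE => /(_ (val v)).
move: le_v; rewrite !(laplacian_mulE, ffunE) inC -/C.
(* With [d] the out-degree in [G], the bounds give [x v >= dC + (d - dC) * f v], which is at least
   [d] since [f v >= 1] and [dC <= d]. *)
move: (outdeg (induced G C) v) (\sum_u mult G u (val v) * f u)%N (val v) fv outC {inC} => dC i {}v fv dC_le; nia.
Qed.

(** Induction on the total demand: a firing leaves [y] unchanged and can only shrink the support of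
    [f], so the condition on components is inherited. *)
Lemma reachable_of_demand x y f :
  to_int y = to_int x + laplacian_mul G (to_int f) ->
  (forall C : {set V}, strong_component G C ->
     restrict C f = [ffun=> 0%N] \/ recurrent (induced G C) (restrict C y)) ->
  reachable G x y.
Proof.
have [n] := ubnP (\sum_v f v)%N; elim: n => // n IH in x f *.
move=> le_fn yE hC.
have [/existsP f_gt0|] := boolP [exists v, 0 < f v]%N; last first.
  rewrite negb_exists => /forallP f0.
  have {}f0 v : f v = 0%N by have := f0 v; case: (f v).
  exists [::]; apply/ffunP => v /=; move/ffunP/(_ v): yE.
  rewrite [RHS]ffunE laplacian_mulE !ffunE f0 big1 => [|u _]; last by rewrite f0 muln0.
  by lia.
have [v [fv xv]] := exists_fireable yE hC f_gt0.
pose f' : {ffun V -> nat} := [ffun u => (f u - (u == v))%N].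
have fE : to_int f = char_vec v + to_int f'.
  by apply/ffunP => u; rewrite !ffunE; case: (u =P v) => [->|_] /=; lia.
pose z : {ffun V -> nat} :=
  [ffun u => if u == v then x v - outdeg G v else x u + mult G v u]%N.
have zE : to_int z = to_int x + laplacian_mul G (char_vec v).
  apply/ffunP => u; rewrite !ffunE (bigD1 v) //= ffunE eqxx mulr1 big1 => [|w wv].
    by rewrite addr0 /laplacian; case: (u =P v) => [->|_]; lia.
  by rewrite ffunE (negPf wv) mulr0.
have [|||s zs] := IH z f'.
- apply: leq_trans (le_fn : _ <= n)%N; rewrite (bigD1 v) // [ltnRHS](bigD1 v) //= ffunE eqxx.
  have -> : (\sum_(i | i != v) f' i = \sum_(i | i != v) f i)%N.
    by apply: eq_bigr => u uv; rewrite ffunE (negPf uv) subn0.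
  by lia.
- by rewrite yE fE laplacian_mulD zE addrA.
- move=> C /hC[fC0|]; [left | by right].
  apply/ffunP => u; move/ffunP/(_ u): fC0; rewrite !ffunE; lia.
by exists (v :: s), z.
Qed.

End StrongComponents.

Unset Implicit Arguments.

Theorem theorem4p4 (V : finType) (G : digraph V) (hG : weakly_connected G)
    (x y f : {ffun V -> nat})
    (hf : to_int y = to_int x + laplacian_mul G (to_int f))
    (hC : forall C : {set V}, strong_component G C ->
       restrict C f = [ffun=> 0%N] \/ recurrent (induced G C) (restrict C y)) :
  reachable G x y.
Proof. exact: reachable_of_demand hf hC. Qed.
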